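(* Let $(R,\mathfrak m)$ be a regular local ring with $\dim R=3$ and let $I$ be an ideal of $R$ such that $I^{n+1}:I=I^n$ for all $n\geq 1$. Then $\operatorname{depth}R/I^{n+1}\leq \operatorname{depth}R/I^n$ for all $n\geq 1$, i.e. the function $n\mapsto \operatorname{depth} R/I^n$ is non-increasing. *)

(* Defs.v *)
From HB Require Import structures.
From mathcomp Require Import all_boot all_order all_algebra.
Set Implicit Arguments. Unset Strict Implicit. Unset Printing Implicit Defensive.
Import GRing.Theory.
Local Open Scope ring_scope.

Section CommAlg.
Variable R : comUnitRingType.

Definition is_ideal (I : R -> Prop) : Prop :=
  I 0 /\ (forall x y, I x -> I y -> I (x + y)) /\ (forall a x, I x -> I (a * x)).

Definition ideal_eq (I J : R -> Prop) : Prop := forall x, I x <-> J x.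
Definition ideal_sub (I J : R -> Prop) : Prop := forall x, I x -> J x.

Definition gen_by (s : seq R) : R -> Prop :=
  fun x => exists c : nat -> R, x = \sum_(i < size s) c i * s`_i.

Definition ideal_mul (I J : R -> Prop) : R -> Prop :=
  fun x => exists s : seq (R * R),
    (forall p, p \in s -> I p.1 /\ J p.2) /\ x = \sum_(p <- s) p.1 * p.2.

Fixpoint ideal_pow (I : R -> Prop) (n : nat) : R -> Prop :=
  match n with
  | 0 => fun _ => True
  | n'.+1 => ideal_mul (ideal_pow I n') I
  end.

Definition ideal_colon (J I : R -> Prop) : R -> Prop :=
  fun x => forall y, I y -> J (x * y).

Definition prime_ideal (P : R -> Prop) : Prop :=
  is_ideal P /\ ~ P 1 /\ (forall a b, P (a * b) -> P a \/ P b).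

Definition prime_chain (P : nat -> R -> Prop) (k : nat) : Prop :=
  (forall i, (i <= k)%N -> prime_ideal (P i)) /\
  (forall i, (i < k)%N -> ideal_sub (P i) (P i.+1) /\ ~ ideal_sub (P i.+1) (P i)).

Definition krull_dim_eq (d : nat) : Prop :=
  (exists P, prime_chain P d) /\ (forall P k, prime_chain P k -> (k <= d)%N).

Definition noetherian : Prop :=
  forall I, is_ideal I -> exists s : seq R, ideal_eq I (gen_by s).

Definition local_ring (m : R -> Prop) : Prop :=
  is_ideal m /\ ~ m 1 /\ (forall x, ~ m x -> x \is a GRing.unit).

Definition regular_local_ring (m : R -> Prop) (d : nat) : Prop :=
  noetherian /\ local_ring m /\ krull_dim_eq d /\
  exists s : seq R, size s = d /\ ideal_eq m (gen_by s).

Definition ideal_add_gen (J : R -> Prop) (xs : seq R) : R -> Prop :=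
  fun x => exists y c, J y /\ x = y + \sum_(i < size xs) c i * xs`_i.

Definition regular_seq (m J : R -> Prop) (xs : seq R) : Prop :=
  (forall x, x \in xs -> m x) /\
  (forall i, (i < size xs)%N -> forall y,
      ideal_add_gen J (take i xs) (xs`_i * y) -> ideal_add_gen J (take i xs) y) /\
  ~ ideal_add_gen J xs 1.

(* depth R/J1 <= depth R/J2 (depth = sup of lengths of regular sequences in m,
   with the usual convention depth 0 = +oo handled by the sup over an empty
   family only when R/J = 0) *)
Definition depth_le (m J1 J2 : R -> Prop) : Prop :=
  forall xs, regular_seq m J1 xs ->
    exists ys, regular_seq m J2 ys /\ (size xs <= size ys)%N.

End CommAlg.

(* Main.v *)
(** If [I^{n+1} : I = I^n], then an element regular on [R/I^{n+1}] is regular on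
    [R/I^n], which settles [depth R/I^{n+1} <= 1]. If [x1, x2] is a regular
    sequence on [R/J] with [J = I^{n+1}], prime avoidance replaces it by a
    regular sequence [s, t] that is part of a generating set [s, t, u] of [m].
    Modulo [(s, t)] the maximal ideal is principal, so [J] becomes principal,
    and Nakayama lifts this to [J = (f)]. The colon condition makes [f] a
    nonzerodivisor, so [I] is invertible, hence [I = (a)]. Multiplication by [a]
    then carries regular sequences on [R/I^{n+1}] back to [R/I^n]. *)
Require Import Defs.
From HB Require Import structures.
From mathcomp Require Import all_boot all_order all_algebra.
From mathcomp Require Import ring.
From Stdlib Require Import Classical ClassicalEpsilon.
From Stdlib Require Import FunctionalExtensionality PropExtensionality.
Set Implicit Arguments. Unset Strict Implicit. Unset Printing Implicit Defensive.
Import GRing.Theory.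
Local Open Scope ring_scope.

Section Ideals.
Variable R : comUnitRingType.
Implicit Types (I J M N m : R -> Prop) (x y z u : R).

(** * Ideal arithmetic, adjoining one generator, and Noetherian maximality *)

Lemma mem_eq J x y : J x -> y = x -> J y.
Proof. by move=> Jx ->. Qed.

Lemma ideal0 J : is_ideal J -> J 0.
Proof. by case. Qed.

Lemma idealD J x y : is_ideal J -> J x -> J y -> J (x + y).
Proof. by move=> [_ [JD _]]; apply: JD. Qed.

Lemma idealMl J a x : is_ideal J -> J x -> J (a * x).
Proof. by move=> [_ [_ JM]]; apply: JM. Qed.

Lemma idealMr J a x : is_ideal J -> J x -> J (x * a).
Proof. by rewrite mulrC; apply: idealMl. Qed.

Lemma idealN J x : is_ideal J -> J x -> J (- x).
Proof. by rewrite -mulN1r; apply: idealMl. Qed.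

Lemma idealB J x y : is_ideal J -> J x -> J y -> J (x - y).
Proof. by move=> hJ Jx Jy; apply: idealD => //; apply: idealN. Qed.

Lemma idealDl J x y : is_ideal J -> J x -> J (x + y) -> J y.
Proof. by move=> hJ Jx Jxy; apply: (mem_eq (idealB hJ Jxy Jx)); ring. Qed.

Lemma ideal_sum J (T : Type) (r : seq T) (P : pred T) (F : T -> R) :
  is_ideal J -> (forall i, P i -> J (F i)) -> J (\sum_(i <- r | P i) F i).
Proof.
move=> hJ JF; elim/big_ind: _ => //; first exact: ideal0.
by move=> x y; apply: idealD.
Qed.

Lemma ideal_unit J x : is_ideal J -> x \is a GRing.unit -> J x -> J 1.
Proof. by move=> hJ Ux Jx; rewrite -(mulVr Ux); apply: idealMl. Qed.

Lemma ideal_cancel_unit J x y :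
  is_ideal J -> x \is a GRing.unit -> J (x * y) -> J y.
Proof. by move=> hJ Ux Jxy; rewrite -(mulKr Ux y); apply: idealMl. Qed.

Definition zero_ideal x := x = 0.

Lemma zero_is_ideal : is_ideal zero_ideal.
Proof.
rewrite /zero_ideal; split=> //; split=> [x y -> ->|a x ->].
  by rewrite addr0.
by rewrite mulr0.
Qed.

Definition add_principal J x : R -> Prop :=
  fun y => exists z c, J z /\ y = z + c * x.

Lemma add_principal_ideal J x : is_ideal J -> is_ideal (add_principal J x).
Proof.
move=> hJ; split; first by exists 0, 0; rewrite mul0r addr0; split=> //; apply: ideal0.
split=> [_ _ [y [c [Jy ->]]] [z [d [Jz ->]]] | a _ [y [c [Jy ->]]]].
  by exists (y + z), (c + d); split; [apply: idealD | ring].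
by exists (a * y), (a * c); split; [apply: idealMl | ring].
Qed.

Lemma sub_add_principal J x y : J y -> add_principal J x y.
Proof. by move=> Jy; exists y, 0; rewrite mul0r addr0. Qed.

Lemma mem_add_principal J x c : is_ideal J -> add_principal J x (c * x).
Proof. by move=> hJ; exists 0, c; rewrite add0r; split=> //; apply: ideal0. Qed.

Lemma add_principal_min J M x :
  is_ideal M -> ideal_sub J M -> M x -> ideal_sub (add_principal J x) M.
Proof.
by move=> hM JM Mx _ [z [c [Jz ->]]]; apply: idealD => //; [apply: JM | apply: idealMl].
Qed.

Lemma add_principal_mono J M x :
  ideal_sub J M -> ideal_sub (add_principal J x) (add_principal M x).
Proof. by move=> JM _ [z [c [Jz ->]]]; exists z, c; split=> //; apply: JM. Qed.

Lemma add_principal_comm J x y :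
  ideal_sub (add_principal (add_principal J x) y) (add_principal (add_principal J y) x).
Proof.
move=> _ [_ [d [[z [c [Jz ->]]] ->]]].
by exists (z + d * y), c; split; [exists z, d | ring].
Qed.

Lemma add_principal_id J x : is_ideal J -> add_principal J x x.
Proof.
by move=> hJ; rewrite -[X in add_principal _ _ X]mul1r; apply: mem_add_principal.
Qed.

Definition regular_mod J x := forall y, J (x * y) -> J y.

Lemma mem_gen_by (s : seq R) x : x \in s -> gen_by s x.
Proof.
move=> /(nthP 0) [i lt_i <-]; exists (fun j => (j == i)%:R).
rewrite (bigD1 (Ordinal lt_i)) //= eqxx mul1r big1 ?addr0 // => j.
by rewrite -val_eqE /= => /negPf ->; rewrite mul0r.
Qed.

Lemma regular_modM J x y : regular_mod J x -> regular_mod J y -> regular_mod J (x * y).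
Proof. by move=> xreg yreg z; rewrite -mulrA => /xreg /yreg. Qed.

(** Otherwise dependent choice yields a strictly ascending chain, whose union is finitely generated,
    so that the chain stops. The index type [T] will be elements, pairs, lists or ideals. *)
Lemma noetherian_max (T : Type) (D : T -> Prop) (F : T -> R -> Prop) (t0 : T) :
  noetherian R -> (forall t, D t -> is_ideal (F t)) -> D t0 ->
  exists2 t, D t & forall t', D t' -> ideal_sub (F t) (F t') -> ideal_sub (F t') (F t).
Proof.
move=> noeR idF Dt0; apply: NNPP => nomax.
have next t : exists t', D t -> [/\ D t', ideal_sub (F t) (F t') & ~ ideal_sub (F t') (F t)].
  case: (classic (D t)) => Dt; last by exists t.
  apply: NNPP => nt; apply: nomax; exists t => // t' Dt' le.
  by apply: NNPP => nle; apply: nt; exists t'.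
pose f t := proj1_sig (constructive_indefinite_description _ (next t)).
have fP t : D t -> [/\ D (f t), ideal_sub (F t) (F (f t)) & ~ ideal_sub (F (f t)) (F t)].
  exact: (proj2_sig (constructive_indefinite_description _ (next t))).
pose g k := iter k f t0.
have Dg k : D (g k) by elim: k => //= k IH; case: (fP _ IH).
have g_mono j k : (j <= k)%N -> ideal_sub (F (g j)) (F (g k)).
  move=> /subnK <-; elim: (k - j)%N => [|i IH] x Fx //.
  by case: (fP _ (Dg (i + j)%N)) => _ + _; apply; apply: IH.
pose U x := exists k, F (g k) x.
have hU : is_ideal U.
  split; first by exists 0%N; apply: ideal0; apply: idF.
  split=> [x y [j Fx] [k Fy] | a x [k Fx]]; last first.
    by exists k; apply: idealMl => //; apply: idF.
  exists (maxn j k); apply: idealD; first exact: idF.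
    by apply: g_mono Fx; apply: leq_maxl.
  by apply: g_mono Fy; apply: leq_maxr.
have [s sP] := noeR U hU.
have genU x : x \in s -> U x by move=> xs; apply/sP/mem_gen_by.
have [k sk] : exists k, forall x, x \in s -> F (g k) x.
  elim: s {sP} genU => [|a s IH] sU; first by exists 0%N.
  have [x xs|k sk] := IH; first by apply: sU; rewrite in_cons xs orbT.
  have [j Fa] := sU a (mem_head _ _).
  exists (maxn j k) => x; rewrite in_cons => /orP [/eqP ->|xs].
    by apply: g_mono Fa; apply: leq_maxl.
  by apply: g_mono (sk x xs); apply: leq_maxr.
case: (fP _ (Dg k)) => _ _; apply => x Fx.
have [|c ->] := (sP x).1; first by exists k.+1.
apply: ideal_sum => [|i _]; first exact: idF.
by apply: idealMl; [apply: idF | apply: sk; apply: mem_nth].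
Qed.

(** * Prime avoidance by maximal annihilators modulo [J] *)

Section Avoidance.
Variable J : R -> Prop.
Hypothesis noeR : noetherian R.
Hypothesis hJ : is_ideal J.

Definition ann_mod z : R -> Prop := fun a => J (a * z).

Lemma ann_mod_ideal z : is_ideal (ann_mod z).
Proof.
rewrite /ann_mod; split; first by rewrite mul0r; apply: ideal0.
split=> [x y Jx Jy|a x Jx]; first by rewrite mulrDl; apply: idealD.
by rewrite -mulrA; apply: idealMl.
Qed.

(** Then [ann_mod z] is a maximal annihilator of a nonzero element of $R/J$, hence an associated
    prime; these primes cover the zero divisors on $R/J$. *)
Definition max_ann z :=
  ~ J z /\ forall z', ~ J z' -> ideal_sub (ann_mod z) (ann_mod z') ->
                      ideal_sub (ann_mod z') (ann_mod z).

Lemma max_ann_above z :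
  ~ J z -> exists2 z', max_ann z' & ideal_sub (ann_mod z) (ann_mod z').
Proof.
move=> nJz.
have [||z' [nJz' le] z'max] := @noetherian_max R
    (fun z' => ~ J z' /\ ideal_sub (ann_mod z) (ann_mod z')) ann_mod z noeR.
- by move=> *; apply: ann_mod_ideal.
- by split.
exists z' => //; split=> // z2 nJz2 le2; apply: z'max => //; split=> // x /le.
exact: le2.
Qed.

(** By maximality [b * z] has the same annihilator as [z]. *)
Lemma max_ann_prime z a b :
  max_ann z -> ~ J (a * z) -> ~ J (b * z) -> ~ J (a * b * z).
Proof.
move=> [nJz zmax] nJa nJb Jab; apply: nJa; apply: (zmax (b * z)) => // [x|].
  by rewrite /ann_mod mulrCA; apply: idealMl.
by rewrite /ann_mod mulrA.
Qed.

(** The element [v] shows that [ann_mod z] differs from each [ann_mod z']. By maximality some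
    multiplier kills [z'] but not [z], and the product of these multipliers works because
    [ann_mod z] is prime. *)
Lemma ann_separation (l : seq R) v z :
  (forall z', z' \in l -> max_ann z' /\ ~ J (v * z')) -> max_ann z -> J (v * z) ->
  exists2 p, (forall z', z' \in l -> J (p * z')) & ~ J (p * z).
Proof.
move=> + zmax Jvz; elim: l => [|z1 l IH] lP.
  by exists 1 => //; rewrite mul1r; case: zmax.
have [z' lz'|p lp npz] := IH; first by apply: lP; rewrite in_cons lz' orbT.
have [z1max nJvz1] := lP z1 (mem_head _ _).
have [q [Jqz1 nJqz]] : exists q, J (q * z1) /\ ~ J (q * z).
  apply: NNPP => noq; apply: nJvz1; case: z1max => _ /(_ z); apply=> //.
    by case: zmax.
  by move=> q Jq; apply: NNPP => nJq; apply: noq; exists q.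
exists (p * q); last exact: max_ann_prime.
move=> z'; rewrite in_cons => /orP [/eqP ->|/lp Jp].
  by rewrite -mulrA; apply: idealMl.
by rewrite mulrAC; apply: idealMr.
Qed.

(* In the proof, the double annihilator [F l] replaces the ideal generated by
   [J] and [l]; a maximal [F l] exists because [R] is noetherian. *)
Lemma finite_max_ann :
  exists2 l : seq R, (forall z, z \in l -> max_ann z) &
    forall z p, max_ann z -> (forall z', z' \in l -> J (p * z')) -> J (p * z).
Proof.
pose F (l : seq R) y := forall p, (forall z, z \in l -> J (p * z)) -> J (p * y).
have [l _| |l lmax Fmax] := @noetherian_max (seq R)
    (fun l => forall z, z \in l -> max_ann z) F [::] noeR => //.
  split; first by move=> p _; rewrite mulr0; apply: ideal0.
  split=> [x y Fx Fy p lp|a x Fx p lp].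
    by rewrite mulrDr; apply: idealD => //; [apply: Fx | apply: Fy].
  by rewrite mulrCA; apply: idealMl => //; apply: Fx.
exists l => // z p zmax; apply: (Fmax (z :: l)) => [z'|y Fy q qP|q]; last 1 first.
- by apply; rewrite mem_head.
- by rewrite in_cons => /orP [/eqP ->|/lmax].
- by apply: Fy => z' lz'; apply: qP; rewrite in_cons lz' orbT.
Qed.

(** It suffices to avoid the finitely many annihilators of [finite_max_ann], and [w] is corrected
    for one of them at a time. *)
Lemma regular_in_coset x u :
  regular_mod J x -> exists w, regular_mod J (u + x * w).
Proof.
move=> xreg; have [l lmax lall] := finite_max_ann.
have [w wP] : exists w, forall z, z \in l -> ~ J ((u + x * w) * z).
  elim: l lmax {lall} => [|z l IH] lmax; first by exists 0.
  have [z' lz'|w wP] := IH; first by apply: lmax; rewrite in_cons lz' orbT.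
  have zmax := lmax z (mem_head _ _).
  case: (classic (J ((u + x * w) * z))) => Jz; last first.
    by exists w => z'; rewrite in_cons => /orP [/eqP ->|/wP].
  have [|p lp npz] := ann_separation (l := l) _ zmax Jz.
    by move=> z' lz'; split; [apply: lmax; rewrite in_cons lz' orbT | apply: wP].
  (* The correction [x * p] kills all elements of [l], but not [z], because [x] is regular. *)
  exists (w + p) => z'; rewrite in_cons => /orP [/eqP ->|lz'] Jz'.
    apply/npz/xreg; apply: (idealDl hJ Jz).
    by apply: (mem_eq Jz'); ring.
  apply: (wP z' lz'); apply: (idealDl hJ (idealMl x hJ (lp z' lz'))).
  by apply: (mem_eq Jz'); ring.
(* A zero divisor would lie in some maximal annihilator [ann_mod z]; separating [z] from [l]
   contradicts the choice of [l]. *)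
exists w => y Jy; apply: NNPP => nJy.
have [z zmax le] := max_ann_above nJy.
have [|p lp] := ann_separation (l := l) _ zmax (le _ Jy).
  by move=> z' lz'; split; [apply: lmax | apply: wP].
by apply; apply: lall.
Qed.

End Avoidance.

(** * Nakayama arguments and principal ideals in a local ring *)

Section Local.
Variable m : R -> Prop.
Hypothesis noeR : noetherian R.
Hypothesis locR : local_ring m.

Lemma max_is_ideal : is_ideal m. Proof. by case: locR. Qed.

Lemma max_unit x : ~ m x -> x \is a GRing.unit.
Proof. by case: locR => _ [_]; apply. Qed.

Lemma max_nunit x : x \is a GRing.unit -> ~ m x.
Proof.
by case: locR => hm [nm1 _] Ux /(ideal_unit hm Ux).
Qed.

Lemma unit_subr1 x : m x -> 1 - x \is a GRing.unit.
Proof.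
move=> mx; apply: max_unit => m1x; apply: (@max_nunit 1); first exact: unitr1.
by rewrite -(subrK x 1); apply: idealD => //; apply: max_is_ideal.
Qed.

Lemma proper_sub_max J : is_ideal J -> ~ J 1 -> ideal_sub J m.
Proof.
by move=> hJ nJ1 x Jx; apply: NNPP => /max_unit Ux; apply/nJ1/(ideal_unit hJ Ux).
Qed.

(** Take [C] maximal among the ideals that contain [N] but not [M]. Adjoining some [g] of [M]
    outside [C] captures all of [M], and then [(1 - x * d) * g] lies in [C] with a unit factor. *)
Lemma nakayama_principal x M N :
  is_ideal M -> is_ideal N -> m x ->
  (forall y, M y -> exists2 r, M r & N (y - x * r)) -> ideal_sub M N.
Proof.
move=> hM hN mx MN; apply: NNPP => nMN.
have [C [hC _]|//|C [hC NC nMC] Cmax] := @noetherian_max (R -> Prop)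
  (fun C => [/\ is_ideal C, ideal_sub N C & ~ ideal_sub M C]) (fun C => C) N noeR.
- by [].
- by split.
apply: nMC => g Mg; apply: NNPP => nCg.
have MCg : ideal_sub M (add_principal C g).
  apply: NNPP => nMCg; apply: nCg; apply: (Cmax (add_principal C g)).
  - split=> //; first exact: add_principal_ideal.
    by move=> y Ny; apply/sub_add_principal/NC.
  - by move=> y; apply: sub_add_principal.
  - exact: add_principal_id.
have [r Mr Nr] := MN g Mg; have [c [d [Cc def_r]]] := MCg r Mr.
apply: nCg; apply: (@ideal_cancel_unit C (1 - x * d)) => //.
  by apply: unit_subr1; apply: idealMr => //; apply: max_is_ideal.
have -> : (1 - x * d) * g = (g - x * r) + x * c by rewrite def_r; ring.
by apply: idealD => //; [apply: NC | apply: idealMl].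
Qed.

(** Regular sequences of length two permute in a local ring: Nakayama applied to the colon ideal $J
    : s$ gives the regularity of [s]. *)
Lemma regular_mod_swap J x s :
  is_ideal J -> m x -> regular_mod J x -> regular_mod (add_principal J x) s ->
  regular_mod J s /\ regular_mod (add_principal J s) x.
Proof.
move=> hJ mx xreg sreg.
have reg : regular_mod J s.
  have hM : is_ideal (fun y => J (s * y)).
    split; first by rewrite mulr0; apply: ideal0.
    split=> [y z|a y Jy]; first by rewrite mulrDr; apply: idealD.
    by rewrite mulrCA; apply: idealMl.
  apply: (nakayama_principal hM hJ mx) => y Jsy.
  have [z [r [Jz def_y]]] := sreg y (sub_add_principal x Jsy).
  exists r; last by rewrite def_y mulrC addrK.
  apply: xreg; apply: (idealDl hJ (idealMl s hJ Jz)).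
  by apply: (mem_eq Jsy); rewrite def_y; ring.
split=> // y [z [c [Jz def_xy]]].
have [|z' [d [Jz' def_c]]] := sreg c.
  exists (- z), y; split; first exact: idealN.
  by rewrite mulrC [y * x]mulrC def_xy addKr.
exists (y - d * s), d; split; last by rewrite subrK.
apply: xreg; rewrite mulrBr def_xy def_c.
have -> : z + (z' + d * x) * s - x * (d * s) = z + s * z' by ring.
by apply: idealD => //; apply: idealMl.
Qed.

(** When the maximal ideal of $R/N$ is principal, divisibility is total there. In an incomparable
    pair with $N + (a)$ maximal, both members are multiples of [u] modulo [N]; dividing by [u] keeps
    them incomparable, so maximality puts [a1] in $N + (a)$, which forces [a] into [N]. *)
Lemma divisibility_total N u a b :
  is_ideal N -> ideal_sub m (add_principal N u) -> m u ->
  add_principal N b a \/ add_principal N a b.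
Proof.
move=> hN mNu mu; apply: NNPP => bad0.
pose bad (p : R * R) :=
  ~ add_principal N p.2 p.1 /\ ~ add_principal N p.1 p.2.
have [p _||] := @noetherian_max (R * R) bad (fun p => add_principal N p.1) (a, b) noeR.
- exact: add_principal_ideal.
- by split=> /= h; apply: bad0; [left|right].
move=> {a b bad0} [a b] [/= nba nab] amax.
have in_m x y : ~ add_principal N x y -> m x.
  move=> nxy; apply: NNPP => /max_unit Ux; apply: nxy.
  by rewrite -(divrK Ux y); apply: mem_add_principal.
have [a0 [a1 [Na0 def_a]]] := mNu a (in_m _ _ nab).
have [b0 [b1 [Nb0 def_b]]] := mNu b (in_m _ _ nba).
have lift x0 x1 y0 y1 : N x0 -> N y0 -> add_principal N x1 y1 ->
    add_principal N (x0 + x1 * u) (y0 + y1 * u).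
  move=> Nx0 Ny0 [z [c [Nz ->]]].
  exists (y0 + z * u - c * x0), c; split; last by ring.
  by apply: idealB => //; [apply: idealD => //; apply: idealMr | apply: idealMl].
have [|||z [c [Nz def_a1]]] := amax (a1, b1) _ _ a1.
- by split=> /= h; [apply: nba | apply: nab]; rewrite def_a def_b; apply: lift.
- apply: add_principal_min => /=; first exact: add_principal_ideal.
    by move=> y; apply: sub_add_principal.
  rewrite def_a; apply: idealD; first exact: add_principal_ideal.
    exact: sub_add_principal.
  by rewrite mulrC; apply: mem_add_principal.
- exact: add_principal_id.
have Na1 : N a1.
  apply: (@ideal_cancel_unit N (1 - c * u)) => //.
    by apply: unit_subr1; apply: idealMl => //; apply: max_is_ideal.
  have -> : (1 - c * u) * a1 = z + c * a0.
    by rewrite mulrBl mul1r [X in X - _]def_a1 def_a; ring.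
  by apply: idealD => //; apply: idealMl.
apply: nba; apply: sub_add_principal; rewrite def_a.
by apply: idealD => //; apply: idealMr.
Qed.

Lemma principal_mod N J u :
  is_ideal N -> is_ideal J -> ideal_sub m (add_principal N u) -> m u ->
  exists2 g, J g & ideal_sub J (add_principal N g).
Proof.
move=> hN hJ mNu mu.
have [g _||g Jg gmax] := @noetherian_max R J (add_principal N) 0 noeR.
- exact: add_principal_ideal.
- exact: ideal0.
exists g => // y Jy.
case: (divisibility_total y g hN mNu mu) => // gy; apply: (gmax y) => //;
  last exact: add_principal_id.
apply: add_principal_min => //; first exact: add_principal_ideal.
by move=> z; apply: sub_add_principal.
Qed.

(** Regularity of [s] puts the coefficient of [s] back into [J], so $J \subseteq N + (g) + sJ$ and
    Nakayama applies. *)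
Lemma principal_lift N J s g :
  is_ideal N -> is_ideal J -> m s -> J g -> ideal_sub N J -> regular_mod J s ->
  ideal_sub J (add_principal (add_principal N g) s) ->
  ideal_sub J (add_principal N g).
Proof.
move=> hN hJ ms Jg NJ sreg Jsub.
apply: (@nakayama_principal s) => // [|y Jy]; first exact: add_principal_ideal.
have [z [c [Nz def_y]]] := Jsub y Jy.
exists c; last by rewrite def_y mulrC addrK.
apply: sreg; have Jz : J z by apply: (add_principal_min hJ NJ Jg).
by apply: (idealDl hJ Jz); rewrite mulrC -def_y.
Qed.

(** Modulo the new ideal [c * s] equals [- x * (c * r)], so Nakayama absorbs the change of
    generator. *)
Lemma exchange N s x r :
  is_ideal N -> ideal_sub m (add_principal N s) -> m x -> m r ->
  ideal_sub m (add_principal N (s + x * r)).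
Proof.
move=> hN mNs mx mr; have hm := max_is_ideal.
apply: (nakayama_principal hm _ mx) => [|y my]; first exact: add_principal_ideal.
have [z [c [Nz ->]]] := mNs y my.
exists (- c * r); first exact: idealMl.
by exists z, c; split=> //; ring.
Qed.

Lemma depth_two_principal J x1 x2 s0 s1 s2 :
  is_ideal J -> m s0 -> m s1 -> m s2 -> m x1 -> m x2 ->
  ideal_sub m
    (add_principal (add_principal (add_principal zero_ideal s2) s1) s0) ->
  regular_mod J x1 -> regular_mod (add_principal J x1) x2 ->
  exists2 g, J g & ideal_sub J (add_principal zero_ideal g).
Proof.
move=> hJ ms0 ms1 ms2 mx1 mx2 m_gen x1reg x2reg; have hm := max_is_ideal.
have h0 := zero_is_ideal; have hP N x : is_ideal N -> is_ideal (add_principal N x).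
  exact: add_principal_ideal.
(* Using the square of [x2] makes the correction [x2 * (x2 * w)] a product of two elements of [m],
   as [exchange] requires. The same device gives [t] below. *)
have [w] := regular_in_coset noeR (hP _ x1 hJ) s0 (regular_modM x2reg x2reg).
rewrite -mulrA; set s := s0 + _ => sreg1.
have ms : m s by apply: idealD => //; apply: idealMr.
have [sreg x1regs] := regular_mod_swap hJ mx1 x1reg sreg1.
have [w'] := regular_in_coset noeR (hP _ s hJ) s1 (regular_modM x1regs x1regs).
rewrite -mulrA; set t := s1 + _ => treg.
have mt : m t by apply: idealD => //; apply: idealMr.
have m_gen' : ideal_sub m
    (add_principal (add_principal (add_principal zero_ideal s) t) s2).
  have m_gen1 : ideal_sub m
      (add_principal (add_principal (add_principal zero_ideal s2) s) s1).
    move=> y my; apply: add_principal_comm.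
    apply: (exchange _ m_gen mx2 _ my); last exact: idealMr.
    by apply/hP/hP.
  move=> y my; apply: add_principal_comm.
  apply: (add_principal_mono (@add_principal_comm zero_ideal s2 s)).
  apply: (exchange _ m_gen1 mx1 _ my); last exact: idealMr.
  by apply/hP/hP.
have [g Jg Jsub] := principal_mod (hP _ t (hP _ s h0)) hJ m_gen' ms2.
exists g => //.
have zJ : ideal_sub zero_ideal J by move=> _ ->; apply: ideal0.
(* Starting from $J \subseteq (s, t, g)$, the inner lift removes [t] over the base $(s)$, and this
   outer lift removes [s]. *)
apply: (principal_lift h0 hJ ms Jg zJ sreg) => y Jy.
apply: add_principal_comm.
apply: (principal_lift (hP _ s h0) (hP _ s hJ) mt _ _ treg) => [||{Jy}y|].
- exact: sub_add_principal.
- exact: add_principal_mono.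
- apply: add_principal_min => [|{}y Jy|].
  + by apply/hP/hP/hP.
  + by apply/add_principal_comm/Jsub.
  + by do 2!apply: sub_add_principal; apply: add_principal_id.
- exact: sub_add_principal.
Qed.

End Local.

(** * Products and powers of ideals *)

Lemma mem_ideal_mul I J x y : I x -> J y -> ideal_mul I J (x * y).
Proof.
move=> Ix Jy; exists [:: (x, y)]; rewrite big_seq1; split=> // p.
by rewrite inE => /eqP ->.
Qed.

Lemma ideal_mul_min I J M :
  is_ideal M -> (forall x y, I x -> J y -> M (x * y)) ->
  ideal_sub (ideal_mul I J) M.
Proof.
move=> hM IJM _ [s [sP ->]]; rewrite big_seq; apply: ideal_sum => // p ps.
by case: (sP p ps) => *; apply: IJM.
Qed.

Lemma ideal_mul_ideal I J : is_ideal I -> is_ideal (ideal_mul I J).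
Proof.
move=> hI; split; first by exists [::]; rewrite big_nil.
split=> [_ _ [s [sP ->]] [t [tP ->]] | a _ [s [sP ->]]].
  exists (s ++ t); rewrite big_cat; split=> // p.
  by rewrite mem_cat => /orP [/sP|/tP].
exists [seq (a * p.1, p.2) | p <- s]; split.
  by move=> _ /mapP [p /sP [Ip Jp] ->]; split=> //; apply: idealMl.
by rewrite big_map mulr_sumr; apply: eq_bigr => p _; rewrite mulrA.
Qed.

Lemma ideal_pow_ideal I n : is_ideal (ideal_pow I n).
Proof. by elim: n => [|n IH] //; apply: ideal_mul_ideal. Qed.

Lemma ideal_powS_sub I n : is_ideal I -> ideal_sub (ideal_pow I n.+1) I.
Proof. by move=> hI; apply: ideal_mul_min => // x y _; apply: idealMl. Qed.

Lemma ideal_pow_factor I j f n y :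
  ideal_sub (ideal_pow I j) (add_principal zero_ideal f) ->
  ideal_pow I (n + j) y -> exists2 z, ideal_pow I n z & y = f * z.
Proof.
move=> Ij_f; elim: n y => [|n IH] y.
  by move=> /Ij_f [z [c [-> ->]]]; exists c; rewrite // add0r mulrC.
move: y; apply: ideal_mul_min => [|_ b /IH [z Iz ->] Ib]; last first.
  by exists (z * b); [apply: mem_ideal_mul | rewrite mulrA].
have hI := ideal_pow_ideal I n.+1.
split; first by exists 0; [apply: ideal0 | rewrite mulr0].
split=> [_ _ [x Ix ->] [z Iz ->]|a _ [z Iz ->]].
  by exists (x + z); [apply: idealD | rewrite mulrDr].
by exists (a * z); [apply: idealMl | rewrite mulrCA].
Qed.

(** * Consequences of the colon condition *)

Section ColonPowers.
Variables m I : R -> Prop.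
Hypothesis noeR : noetherian R.
Hypothesis locR : local_ring m.
Hypothesis hI : is_ideal I.
Hypothesis colonI : forall n, (1 <= n)%N ->
  ideal_eq (ideal_colon (ideal_pow I n.+1) I) (ideal_pow I n).

(** Iterates [colonI], removing one factor of [I] at a time. *)
Lemma colon_ideal_pow j n y :
  (1 <= n)%N -> (forall z, ideal_pow I j z -> ideal_pow I (n + j) (y * z)) ->
  ideal_pow I n y.
Proof.
move=> n_gt0; elim: j => [|j IH] Iy.
  by rewrite -[y]mulr1 -[n]addn0; apply: Iy.
apply: IH => z Iz; apply/colonI; first by rewrite addn_gt0 n_gt0.
by move=> w Iw; rewrite -mulrA -addnS; apply/Iy/mem_ideal_mul.
Qed.

(* The annihilator of [f] lies in the intersection [M] of the powers of [I],
   and this forces [M = f M]. *)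
Lemma pow_generator_regular j f :
  m f -> ideal_sub (ideal_pow I j) (add_principal zero_ideal f) ->
  regular_mod zero_ideal f.
Proof.
move=> mf Ij_f; pose M y := forall n, (1 <= n)%N -> ideal_pow I n y.
have annM y : f * y = 0 -> M y.
  move=> fy0 n n_gt0; apply: (@colon_ideal_pow j) => // z /Ij_f [_ [c [-> ->]]].
  have -> : y * (0 + c * f) = c * (f * y) by ring.
  by rewrite fy0 mulr0; apply: ideal0; apply: ideal_pow_ideal.
have hM : is_ideal M.
  split=> [n _|]; first by apply: ideal0; apply: ideal_pow_ideal.
  split=> [x y Mx My n n1|a x Mx n n1].
    by apply: idealD; [apply: ideal_pow_ideal | apply: Mx | apply: My].
  by apply: idealMl; [apply: ideal_pow_ideal | apply: Mx].
move=> y /annM; apply: (nakayama_principal noeR locR hM zero_is_ideal mf) => {}y My.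
have [z _ def_y] := ideal_pow_factor Ij_f (My (1 + j)%N isT).
exists z; last by rewrite def_y subrr.
(* The factor [z] was chosen once; a factor [z'] in $I^n$ differs from it by an element killed by
   [f], hence by an element of [M]. *)
move=> n n_gt0; have nj_gt0 : (1 <= n + j)%N by rewrite addn_gt0 n_gt0.
have [z' Iz' def_y'] := ideal_pow_factor Ij_f (My _ nj_gt0).
rewrite -(subrK z' z); apply: idealD => //; first exact: ideal_pow_ideal.
by apply: annM; rewrite ?n_gt0 // mulrBr -def_y -def_y' subrr.
Qed.

(** Since $I^n I = (f)$ with [f] regular and the ring is local, a single product [b * a] generates
    $(f)$; cancelling [b] from $bI \subseteq (ba)$ gives $I \subseteq (a)$. *)
Lemma principal_of_pow_principal n f :
  regular_mod zero_ideal f -> ideal_pow I n.+1 f ->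
  ideal_sub (ideal_pow I n.+1) (add_principal zero_ideal f) ->
  exists2 a, I a & ideal_sub I (add_principal zero_ideal a).
Proof.
move=> freg If I_f; have hm := max_is_ideal locR.
have [b [a [Ib Ia [d def_f]]]] :
    exists b a, [/\ ideal_pow I n b, I a & exists d, f = d * (b * a)].
  (* Otherwise every product lies in $K = f\mathfrak m$, so [f] does too, and cancelling [f] makes 1
     an element of [m]. *)
  apply: NNPP => nof; pose K y := exists2 c, m c & y = f * c.
  have hK : is_ideal K.
    split; first by exists 0; [apply: ideal0 | rewrite mulr0].
    split=> [_ _ [c mc ->] [d md ->]|x _ [c mc ->]].
      by exists (c + d); [apply: idealD | rewrite mulrDr].
    by exists (x * c); [apply: idealMl | rewrite mulrCA].
  have [|c mc def_f] := ideal_mul_min hK _ If.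
    move=> b a Ib Ia; have [z [c [-> def_ba]]] := I_f _ (mem_ideal_mul Ib Ia).
    exists c; last by rewrite def_ba add0r mulrC.
    apply: NNPP => /(max_unit locR) Uc; apply: nof; exists b, a; split=> //.
    by exists c^-1; rewrite def_ba add0r mulKr.
  have /freg c1 : f * (1 - c) = 0 by rewrite mulrBr mulr1 -def_f subrr.
  by have := unit_subr1 locR mc; rewrite c1 unitr0.
exists a => // y Iy.
have [z [c [-> def_by]]] := I_f _ (mem_ideal_mul Ib Iy).
exists 0, (c * d); split=> //; rewrite add0r.
suff /freg /eqP : f * (y - c * d * a) = 0 by rewrite subr_eq0 => /eqP.
have -> : f * (y - c * d * a) = d * a * (b * y - c * (d * (b * a))).
  by rewrite def_f; ring.
by rewrite -def_f def_by; ring.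
Qed.

End ColonPowers.

(** The coefficients in [ideal_add_gen] are functions on ordinals below [size s]; on [nat] they can
    be reused when the length changes. *)
Lemma ideal_add_gen_nat J s y :
  ideal_add_gen J s y <->
  exists z (c : nat -> R), J z /\ y = z + \sum_(i < size s) c i * s`_i.
Proof.
split=> [[z [c [Jz ->]]]|[z [c [Jz ->]]]]; last by exists z, (fun i => c i).
exists z, (fun i => odflt 0 (omap c (insub i))); split=> //; congr (_ + _).
by apply: eq_bigr => i _; rewrite valK.
Qed.

(** * Regular sequences by successive adjunction *)

Lemma ideal_add_genE J s : ideal_add_gen J s = foldl (@add_principal) J s.
Proof.
apply: functional_extensionality => y; apply: propositional_extensionality.
elim/last_ind: s y => [|s x IH] y.
  split=> [[z [c [Jz ->]]]|Jy]; first by rewrite big_ord0 addr0.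
  by exists y, (fun=> 0); rewrite big_ord0 addr0.
have sumE (c : nat -> R) :
    \sum_(i < size (rcons s x)) c i * (rcons s x)`_i =
    \sum_(i < size s) c i * s`_i + c (size s) * x.
  rewrite size_rcons big_ord_recr /= nth_rcons ltnn eqxx; congr (_ + _).
  by apply: eq_bigr => i _; rewrite nth_rcons ltn_ord.
rewrite foldl_rcons; split.
  move=> /ideal_add_gen_nat [z [c [Jz ->]]]; rewrite (sumE c) addrA.
  exists (z + \sum_(i < size s) c i * s`_i), (c (size s)); split=> //.
  by apply/IH/ideal_add_gen_nat; exists z, c.
move=> [z [d [/IH /ideal_add_gen_nat [w [c [Jw ->]]] ->]]].
pose c' i := if (i < size s)%N then c i else d.
apply/ideal_add_gen_nat; exists w, c'; rewrite (sumE c') /c' ltnn addrA.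
by split=> //; congr (_ + _ + _); apply: eq_bigr => i _; rewrite ltn_ord.
Qed.

Lemma foldl_add_principal_min J M s :
  is_ideal M -> ideal_sub J M -> (forall x, x \in s -> M x) ->
  ideal_sub (foldl (@add_principal) J s) M.
Proof.
move=> hM; elim: s J => [|x s IH] J JM sM; first exact: JM.
apply: IH => [|y ys].
  by apply: add_principal_min => //; apply: sM; rewrite mem_head.
by apply: sM; rewrite in_cons ys orbT.
Qed.

Lemma sub_foldl_add_principal J s : ideal_sub J (foldl (@add_principal) J s).
Proof.
by elim: s J => [|x s IH] J y Jy //=; apply/IH/sub_add_principal.
Qed.

(** Moving the head into the base ideal, instead of taking prefixes, allows induction on [xs] with
    varying ideals. *)
Fixpoint regular_on J (xs : seq R) : Prop :=
  if xs is x :: xs' then regular_mod J x /\ regular_on (add_principal J x) xs'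
  else True.

Lemma regular_onP J xs :
  regular_on J xs <->
  forall i, (i < size xs)%N ->
    regular_mod (foldl (@add_principal) J (take i xs)) xs`_i.
Proof.
elim: xs J => [//|x xs IH] J /=; split=> [[xreg /IH xsreg] [|i] //|reg].
  exact: xsreg.
by split; [apply: (reg 0%N) | apply/IH => i; apply: (reg i.+1)].
Qed.

Lemma regular_seqE m J xs :
  regular_seq m J xs <->
  [/\ forall x, x \in xs -> m x, regular_on J xs
    & ~ foldl (@add_principal) J xs 1].
Proof.
rewrite -ideal_add_genE; split=> [[xsm [xsreg n1]]|[xsm /regular_onP xsreg n1]].
  split=> //; apply/regular_onP => i /xsreg; rewrite ideal_add_genE; exact.
by split=> //; split=> // i /xsreg; rewrite ideal_add_genE.
Qed.

(* Applied with [N = 0], [A = I^n], [B = a A = I^{n+1}]; along the induction the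
   elements of the sequence are added to all three ideals. *)
Lemma regular_on_descent N A B a d xs :
  is_ideal N -> is_ideal B -> ideal_sub N A -> ideal_sub N B ->
  B (d * a) -> ideal_sub B (add_principal N (d * a)) -> regular_mod N (d * a) ->
  (forall z, A z -> B (a * z)) ->
  (forall y, B y -> exists2 z, A z & N (y - a * z)) ->
  is_ideal A -> regular_on B xs -> regular_on A xs.
Proof.
elim: xs N A B => [//|x xs IH] N A B hN hB NA NB Bf B_f freg AB BA hA /=.
move=> [xreg xsreg].
have areg : regular_mod N a.
  by move=> y /(idealMl d hN); rewrite mulrA => /freg.
split.
  move=> y Axy; have /xreg /BA [z Az Nz] : B (x * (a * y)).
    by apply: (mem_eq (AB _ Axy)); ring.
  rewrite -(subrK z y); apply: idealD => //.
  by apply/NA/areg; rewrite mulrBr.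
apply: (IH (add_principal N x)) xsreg.
- exact: add_principal_ideal.
- exact: add_principal_ideal.
- exact: add_principal_mono.
- exact: add_principal_mono.
- exact: sub_add_principal.
- move=> _ [y [c [/B_f By ->]]].
  by apply: add_principal_comm; exists y, c.
(* [d * a] stays regular modulo $N + (x)$: regularity of [x] puts [c] in [B], so [c] is a multiple
   of [d * a] modulo [N], and [d * a] cancels. *)
- move=> y [e [c [Ne def_fy]]].
  have /xreg /B_f [e' [q [Ne' def_c]]] : B (x * c).
    apply: (mem_eq (idealB hB (idealMl y hB Bf) (NB _ Ne))).
    by rewrite [y * _]mulrC def_fy; ring.
  exists (y - q * x), q; split; last by rewrite subrK.
  apply: freg; apply: (mem_eq (idealD hN Ne (idealMl x hN Ne'))).
  by rewrite mulrBr def_fy def_c; ring.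
- move=> _ [z [c [Az ->]]]; exists (a * z), (a * c).
  by split; [apply: AB | ring].
- move=> _ [y [c [/BA [z Az Nz] ->]]].
  exists z; first exact: sub_add_principal.
  by exists (y - a * z), c; split=> //; ring.
- exact: add_principal_ideal.
Qed.

End Ideals.

Theorem theorem3p1 (R : comUnitRingType) (m I : R -> Prop) :
  regular_local_ring m 3 ->
  is_ideal I ->
  (forall n, (1 <= n)%N ->
     ideal_eq (ideal_colon (ideal_pow I n.+1) I) (ideal_pow I n)) ->
  forall n, (1 <= n)%N -> depth_le m (ideal_pow I n.+1) (ideal_pow I n).
Proof.
move=> [noeR [locR [_ [s [size_s m_s]]]]] hI colonI n n_gt0 xs /regular_seqE.
move=> [xsm xsreg xs1]; exists xs; split=> //; have hm := max_is_ideal locR.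
have hJ := ideal_pow_ideal I n.+1; have hA := ideal_pow_ideal I n.
have Jm : ideal_sub (ideal_pow I n.+1) m.
  by apply: proper_sub_max => // J1; apply/xs1/sub_foldl_add_principal.
have Am : ideal_sub (ideal_pow I n) m.
  (* If 1 is in $I^n$ with $n \geq 1$, then it is in [I], hence in $I^{n+1}$. *)
  apply: proper_sub_max => // A1; apply/xs1/sub_foldl_add_principal.
  rewrite -[1]mulr1; apply: mem_ideal_mul => //.
  by case: n n_gt0 A1 {xsreg xs1 hJ hA Jm} => // n _; apply: ideal_powS_sub.
apply/regular_seqE; split=> //; last first.
  move/(foldl_add_principal_min hm Am xsm); apply: max_nunit locR _ _.
  exact: unitr1.
case: xs xsm xsreg {xs1} => [//|x1 [|x2 xs]] xsm xsreg.
  (* For [w] in [I], [x1 * y * w] lies in $I^{n+1}$; cancel [x1] and apply the colon condition. *)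
  case: xsreg => x1reg _; split=> // y Axy; apply/colonI => // w Iw.
  by apply: x1reg; rewrite mulrA; apply: mem_ideal_mul.
have [x1reg [x2reg _]] := xsreg.
case: s size_s m_s => [|s0 [|s1 [|s2 [|//]]]] // _ m_s.
have ms z : z \in [:: s0; s1; s2] -> m z by move=> zs; apply/m_s/mem_gen_by.
have m_gen : ideal_sub m
    (add_principal (add_principal (add_principal (@zero_ideal R) s2) s1) s0).
  move=> y /m_s [c ->]; rewrite !big_ord_recr big_ord0 /=.
  exists (c 2 * s2 + c 1 * s1), (c 0); split; last by ring.
  exists (c 2 * s2), (c 1); split=> //; exists 0, (c 2).
  by rewrite add0r.
have [|||||f Jf J_f] := depth_two_principal noeR locR hJ _ _ _ _ _ m_gen x1reg x2reg.
- by apply: ms; rewrite !inE eqxx.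
- by apply: ms; rewrite !inE eqxx orbT.
- by apply: ms; rewrite !inE eqxx !orbT.
- by apply: xsm; rewrite !inE eqxx.
- by apply: xsm; rewrite !inE eqxx orbT.
have freg := pow_generator_regular noeR locR colonI (Jm _ Jf) J_f.
have [a Ia I_a] := principal_of_pow_principal locR freg Jf J_f.
(* From $I \subseteq (a)$ follows $I^{n+1} \subseteq a I^n$; in particular [f] is [a * d], the
   generator needed for the descent. *)
have JaA : ideal_sub (ideal_pow I n.+1)
    (fun y => exists2 z, ideal_pow I n z & y = a * z).
  apply: ideal_mul_min => [|b _ Ab /I_a [_ [c [-> ->]]]]; last first.
    by exists (b * c); [apply: idealMr | rewrite add0r; ring].
  split; first by exists 0; [apply: ideal0 | rewrite mulr0].
  split=> [_ _ [x Ax ->] [z Az ->]|e _ [z Az ->]].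
    by exists (x + z); [apply: idealD | rewrite mulrDr].
  by exists (e * z); [apply: idealMl | rewrite mulrCA].
have [d _ def_f] := JaA _ Jf.
apply: (@regular_on_descent R (@zero_ideal R) _ _ a d) xsreg => //.
- exact: zero_is_ideal.
- by move=> _ ->; apply: ideal0.
- by move=> _ ->; apply: ideal0.
- by rewrite mulrC -def_f.
- by rewrite mulrC -def_f.
- by rewrite mulrC -def_f.
- by move=> z Az; rewrite mulrC; apply: mem_ideal_mul.
- by move=> y /JaA [z Az ->]; exists z; rewrite // subrr.
Qed.
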